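(* Let $p$ be any prime. There is no normal Cayley graph of an extraspecial $p$-group which admits instantaneous uniform mixing.
   Context: An extraspecial $p$-group is a finite $p$-group $G$ whose center $Z$ has order $p$ and such that $G/Z\cong(\mathbb{Z}/p\mathbb{Z})^m$ for some $m\ge1$ (its order is then $p^{2n+1}$ for some $n\ge1$). For a finite group $G$ and $S\subseteq G\setminus\{1\}$, $\mathrm{Cay}(G,S)$ is the graph with vertex set $G$ in which $g,h$ are adjacent iff $gh^{-1}\in S$; it is a normal Cayley graph if $S$ is a union of conjugacy classes. Standing assumptions on $S$: closed under inverses, generates $G$, and $S\ne G\setminus\{1\}$. A graph $X$ with adjacency matrix $A$ on $N$ vertices admits instantaneous uniform mixing if for some time $\tau>0$ every entry of $U_A(\tau)=\sum_{k\ge0}\frac{(i\tau)^k}{k!}A^k$ has absolute value $1/\sqrt{N}$. *)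

(* Defs.v *)
From HB Require Import structures.
From mathcomp Require Import all_boot all_order all_algebra all_fingroup.
From mathcomp Require Import all_solvable all_character.
From mathcomp Require Import all_classical all_reals all_analysis.
From mathcomp Require Import complex.

Set Implicit Arguments.
Unset Strict Implicit.
Unset Printing Implicit Defensive.

Import Order.TTheory GRing.Theory Num.Theory.
Import numFieldNormedType.Exports.

Local Open Scope ring_scope.
Local Open Scope complex_scope.

(* For p-groups, the library's [extraspecial] (special with center of prime
   order) is: center of order p and G / 'Z(G) isomorphic to (Z/p)^m, m >= 1. *)
Lemma extraspecial_pgroupP (p : nat) (gT : finGroupType) (G : {group gT}) :
  prime p -> (p.-group G)%g ->
  extraspecial G <->
  #|'Z(G)%g| = p /\
  exists2 m : nat, (0 < m)%N & (G / 'Z(G))%g \isog [set: 'rV['F_p]_m].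
Proof.
move=> p_pr pG; split=> [esG | [oZ [m m_gt0 isoGZ]]].
  have [[PhiZ _] _] := esG; split; first exact: (card_center_extraspecial pG).
  have abE : (p.-abelem (G / 'Z(G)))%g by rewrite -PhiZ Phi_quotient_abelem.
  have ntE : (G / 'Z(G))%g != 1%g.
    apply: contra (extraspecial_nonabelian esG) => /eqP GZ1.
    have := quotient_sub1 (char_norm (center_char G)).
    by rewrite GZ1 sub1G => /esym sGZ; rewrite (abelianS sGZ) ?center_abelian.
  by exists (abelem_dim' (G / 'Z(G))%g).+1; rewrite ?(isog_abelem_rV abE ntE).
have abE : (p.-abelem (G / 'Z(G)))%g.
  by rewrite (isog_abelem isoGZ) mx_Fp_abelem.
have nGZ : ~~ (G \subset 'Z(G))%g.
  rewrite -quotient_sub1 ?(char_norm (center_char G)) // subG1 trivg_card1.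
  rewrite (card_isog isoGZ) cardsT card_mx card_Fp // mul1n.
  by rewrite -[X in _ != X](expn0 p) eqn_exp2l ?prime_gt1 // -lt0n.
have sG'Z : (G^`(1) \subset 'Z(G))%g.
  by rewrite der1_min ?(char_norm (center_char G)) // (abelem_abelian abE).
have G'Z : (G^`(1) = 'Z(G))%g.
  apply/eqP; rewrite eqEcard sG'Z oZ.
  have := cardSg sG'Z; rewrite oZ => /(primeP p_pr).2.
  case/orP => /eqP oG'; last by rewrite oG' /=.
  case/negP: nGZ; rewrite finset.subsetI subxx -[_ && _]/(abelian G).
  by apply/derG1P/eqP; rewrite trivg_card1 oG'.
split; last by rewrite oZ.
split=> //; apply/eqP; rewrite finset.eqEsubset (Phi_min pG) ?(char_norm (center_char G)) //=.
by rewrite -G'Z (Phi_joing pG) joing_subl.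
Qed.

Section Cayley.

Variable gT : finGroupType.
Implicit Types (G : {group gT}) (S : {set gT}).

Definition connection_set G S : Prop :=
  [/\ S \subset G^#%g, (S^-1)%g = S, <<S>>%g = G & S <> G^#%g].

Definition union_of_classes G S : Prop :=
  exists2 C : {set {set gT}}, C \subset classes G & S = finset.cover C.

Definition Cay G S : rel (subg_of G) :=
  [rel g h | (sgval g * (sgval h)^-1)%g \in S].

End Cayley.

Section UniformMixing.

Variable R : realType.

Definition adjacency_mx (V : finType) (e : rel V) : 'M[R[i]]_#|V| :=
  \matrix_(i, j) (e (enum_val i) (enum_val j))%:R.

(* The type ascription selects the entrywise topology on matrices, for the
   topology that the modulus induces on R[i]. *)
Definition transition_mx n (A : 'M[R[i]]_n) (tau : R) : 'M[R[i]]_n :=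
  limn (series (fun k => (('i%C * tau%:C) ^+ k / k`!%:R) *: A ^+ k)
        : nat -> 'M[(R[i] : numFieldType)]_n).

Definition inst_uniform_mixing (V : finType) (e : rel V) : Prop :=
  exists2 tau : R, 0 < tau &
    forall i j, `|transition_mx (adjacency_mx e) tau i j|
                = ((Num.sqrt #|V|%:R)^-1)%:C.

End UniformMixing.

(* Main.v *)
(** Let U = exp(i tau A). Since A is Hermitian, U is unitary, and U inherits
    the symmetries of the Cayley graph, among them t |-> t ^ y * z for z
    central. In an extraspecial group every x outside the center Z is conjugate
    to x * w for every w in Z, so for z <> 1 in Z the rows of U at 1 and z agree
    outside Z. If all entries have modulus b > 0, the inner product of these two
    rows is b^2 |G \ Z| plus a sum over Z of modulus at most b^2 |Z|; it
    vanishes, so |G| <= 2 |Z| = 2p, whereas |G| >= p^3 > 2p. *)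
Require Import Defs.
From mathcomp Require Import all_boot all_order all_algebra all_fingroup.
From mathcomp Require Import all_solvable all_classical all_reals.
From mathcomp Require Import all_analysis complex zify.

Set Implicit Arguments.
Unset Strict Implicit.
Unset Printing Implicit Defensive.

Import Order.TTheory GRing.Theory Num.Theory.
Import numFieldNormedType.Exports.

Local Open Scope ring_scope.
Local Open Scope classical_set_scope.
Local Open Scope complex_scope.

(** * Diagonalized matrices: powers and unitarity *)

Lemma expr_conj_diag_mx (F : fieldType) n (P : 'M[F]_n) (d : 'rV[F]_n) k :
  P \in unitmx ->
  (invmx P *m diag_mx d *m P) ^+ k
  = invmx P *m diag_mx (\row_j (d 0 j ^+ k)) *m P.
Proof.
move=> uP; elim: k => [|k IHk].
  rewrite expr0; have -> : \row_j (d 0 j ^+ 0) = const_mx 1 :> 'rV[F]_n.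
    by apply/rowP => j; rewrite !mxE expr0.
  by rewrite diag_const_mx mulmx1 mulVmx.
rewrite exprS IHk -mulmxE -!mulmxA; congr (_ *m _).
rewrite (mulmxA P) mulmxV // mul1mx mulmxA mulmx_diag; congr (diag_mx _ *m _).
by apply/rowP => j; rewrite !mxE exprS.
Qed.

Lemma expr_conj_diag_mxE (F : fieldType) n (P : 'M[F]_n) (d : 'rV[F]_n) k i j :
  P \in unitmx ->
  ((invmx P *m diag_mx d *m P) ^+ k) i j
  = \sum_l invmx P i l * (d 0 l ^+ k * P l j).
Proof.
move=> uP; rewrite expr_conj_diag_mx // -mulmxA mxE.
by apply: eq_bigr => l _; rewrite mul_diag_mx !mxE.
Qed.

Lemma unitarymx_conj_diag (C : numClosedFieldType) n (P : 'M[C]_n) (d : 'rV[C]_n) :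
  P \is unitarymx -> (forall j, `|d 0 j| = 1) ->
  invmx P *m diag_mx d *m P \is unitarymx.
Proof.
move=> unP d1; rewrite mul_unitarymx // mul_unitarymx //.
  by rewrite invmx_unitary // trmxC_unitary.
apply/unitarymxP; rewrite tr_diag_mx map_diag_mx mulmx_diag -diag_const_mx.
by congr diag_mx; apply/rowP => j; rewrite !mxE -normCK d1 expr1n.
Qed.

Lemma exprmx_invariant (F : fieldType) n (A : 'M[F]_n) (s : 'I_n -> 'I_n) k :
  injective s -> (forall i j, A (s i) (s j) = A i j) ->
  forall i j, (A ^+ k) (s i) (s j) = (A ^+ k) i j.
Proof.
move=> sI As; elim: k => [|k IHk] i j; first by rewrite !mxE (inj_eq sI).
rewrite exprS -mulmxE !mxE (reindex_inj sI) /=.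
by apply: eq_bigr => l _; rewrite As IHk.
Qed.

(** * Convergence, unitarity and symmetries of the matrix exponential *)

Section Convergence.
Variable R : realType.
Local Notation C := (R[i] : numFieldType).

Lemma cvg_real_complex (u : nat -> R) (a : R) :
  u @ \oo --> a -> (fun n => (u n)%:C : C) @ \oo --> (a%:C : C).
Proof.
move=> /cvgrPdist_lt ua; apply/cvgrPdist_lt => e.
(* In [R[i]], [0 < e] forces [e] to be real, so its real part serves as the radius in [R]. *)
rewrite ltcE /= => /andP[/eqP Ime Ree].
have := ua _ Ree; apply: filterS => n.
by rewrite -rmorphB normc_def /= expr0n addr0 sqrtr_sqr ltcE /= Ime eqxx.
Qed.

Lemma exp_coeff_imaginary (x : R) k :
  ('i%C * x%:C) ^+ k / k`!%:R =
  (cos_coeff x k)%:C + 'i%C * (sin_coeff x k)%:C :> R[i].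
Proof.
have ik : 'i%C ^+ k = ((~~ odd k)%:R * (-1) ^+ k./2)%:C
    + 'i%C * ((odd k)%:R * (-1) ^+ k.-1./2)%:C :> R[i].
  rewrite -{1}(odd_double_half k) exprD -mul2n exprM sqr_i.
  case: (boolP (odd k)) => ok /=; rewrite ?mul0r ?mul1r ?rmorph0 ?mulr0 ?addr0 ?add0r.
    (* [sin_coeff] carries the exponent [k.-1./2], which for odd [k] is the exponent of ['i ^+ 2] in
       ['i ^+ k]. *)
    have -> : k.-1./2 = k./2 by case: k ok => // k /= /negbTE ok; rewrite uphalf_half ok.
    by rewrite rmorphXn rmorphN1.
  by rewrite rmorphXn rmorphN1.
rewrite exprMn ik /cos_coeff /sin_coeff /= !rmorphM /= !fmorphV !rmorph_nat !rmorphXn /=.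
by rewrite mulrDl mulrDl !mulrA.
Qed.

Lemma cvg_series_exp_imaginary (x : R) :
  series (fun k => ('i%C * x%:C) ^+ k / k`!%:R : C) @ \oo -->
  ((cos x)%:C + 'i%C * (sin x)%:C : C).
Proof.
have -> : series (fun k => ('i%C * x%:C) ^+ k / k`!%:R : C) =
    (fun n => (series (cos_coeff x) n)%:C + 'i%C * (series (sin_coeff x) n)%:C : C).
  apply/funext => n; rewrite /series /= !rmorph_sum mulr_sumr -big_split.
  by apply: eq_bigr => k _; exact: exp_coeff_imaginary.
apply: cvgD; first apply: cvg_real_complex.
  (* Unlocked, [cos x] is the limit of this very series, so its convergence is the goal. *)
  by rewrite cos.unlock; exact: is_cvg_series_cos_coeff.
apply: cvgM; first exact: cvg_cst.
apply: cvg_real_complex.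
by rewrite sin.unlock; exact: is_cvg_series_sin_coeff.
Qed.

Lemma norm_exp_imaginary (x : R) :
  `|(cos x)%:C + 'i%C * (sin x)%:C| = 1 :> R[i].
Proof. by rewrite normc_def /=; simpc; rewrite /= cos2Dsin2 sqrtr1. Qed.

Lemma cvg_mx_entries m n (F : nat -> 'M[C]_(m, n)) (M : 'M[C]_(m, n)) :
  (forall i j, (fun k => F k i j) @ \oo --> M i j) -> F @ \oo --> M.
Proof.
move=> FM A [P nP PA].
have nearP : \forall k \near \oo, forall ij : 'I_m * 'I_n, P ij.1 ij.2 (F k ij.1 ij.2).
  by apply: filter_forall => -[i j]; exact: FM.
by apply: filterS nearP => k Pk; apply: PA => i j; exact: (Pk (i, j)).
Qed.

(** By the spectral theorem [A] is unitarily diagonalizable with real eigenvalues [r j], so the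
    series tends to the conjugate of a diagonal matrix with entries exp(i tau r_j), all of modulus
    1. Convergence also ensures that the [limn] in [transition_mx] is a genuine limit. *)
Lemma cvg_series_exp_hermsymmx n (A : 'M[R[i]]_n) (tau : R) :
  A \is hermsymmx ->
  exists2 U : 'M[R[i]]_n, U \is unitarymx &
    (series (fun k => (('i%C * tau%:C) ^+ k / k`!%:R) *: A ^+ k)
      : nat -> 'M[C]_n) @ \oo --> (U : 'M[C]_n).
Proof.
move=> hA; set P := spectralmx A; set d := spectral_diag A.
have AE : A = invmx P *m diag_mx d *m P.
  exact/orthomx_spectralP/hermitian_normalmx.
have uP : P \in unitmx := spectral_unit A.
have unP : P \is unitarymx := spectral_unitarymx A.
pose r j := complex.Re (d 0 j).
have dE j : d 0 j = (r j)%:C.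
  by rewrite RRe_real //; exact: (mxOverP (hermitian_spectral_diag_real hA)).
pose e x : R[i] := (cos x)%:C + 'i%C * (sin x)%:C.
exists (invmx P *m diag_mx (\row_j e (tau * r j)) *m P).
  by apply: unitarymx_conj_diag => // j; rewrite mxE norm_exp_imaginary.
apply: cvg_mx_entries => i j.
(* Each entry of a partial sum is a fixed linear combination of partial sums of scalar exponential
   series, one per eigenvalue. *)
have -> : (fun k => (series (fun k => (('i%C * tau%:C) ^+ k / k`!%:R) *: A ^+ k) k
     : 'M[C]_n) i j) =
   (fun m => \sum_l invmx P i l *
      (series (fun k => ('i%C * (tau * r l)%:C) ^+ k / k`!%:R : C) m * P l j)).
  apply/funext => m; rewrite /series /= summxE.
  under [RHS]eq_bigr do rewrite mulr_suml mulr_sumr.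
  rewrite exchange_big /=; apply: eq_bigr => k _.
  rewrite mxE AE expr_conj_diag_mxE // mulr_sumr; apply: eq_bigr => l _.
  rewrite dE rmorphM (mulrA 'i%C) [in RHS]exprMn mulrCA; congr (_ * _).
  by rewrite mulrA; congr (_ * _); exact: mulrAC.
rewrite -mulmxA mxE; apply: cvg_big => [|l _]; first exact: add_continuous.
rewrite mul_diag_mx !mxE; apply: cvgM; first exact: cvg_cst.
apply: cvgM; last exact: cvg_cst.
exact: cvg_series_exp_imaginary.
Qed.

Lemma transition_mx_unitary n (A : 'M[R[i]]_n) (tau : R) :
  A \is hermsymmx -> transition_mx A tau \is unitarymx.
Proof.
move=> /(cvg_series_exp_hermsymmx tau)[U unU cvgU].
by rewrite /transition_mx (cvg_lim _ cvgU).
Qed.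

(** Powers of [A] inherit the symmetry, hence so do the partial sums; both entries are then limits
    of one sequence. *)
Lemma transition_mx_invariant n (A : 'M[R[i]]_n) (tau : R) (s : 'I_n -> 'I_n) :
  A \is hermsymmx -> injective s -> (forall i j, A (s i) (s j) = A i j) ->
  forall i j, transition_mx A tau (s i) (s j) = transition_mx A tau i j.
Proof.
move=> /(cvg_series_exp_hermsymmx tau)[U _ cvgU] sI As i j.
rewrite /transition_mx (cvg_lim _ cvgU) //.
have cvgE i' j' := cvg_comp _ _ cvgU (@coord_continuous C n n i' j' U).
apply: (cvg_unique _ (cvgE (s i) (s j))) => //.
apply: cvg_trans (cvgE i j); apply: near_eq_cvg; apply: nearW => m /=.
rewrite /series /= !summxE; apply: eq_bigr => k _.
by rewrite !mxE exprmx_invariant.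
Qed.

End Convergence.

(** Some commutator [[~ x, y]] is nontrivial; it lies in the derived subgroup, which is the center,
    and generates it since the order is prime. Being central, it satisfies [[~ x, y ^+ i] = [~ x, y]
    ^+ i]. *)
Lemma extraspecial_commg_surj (gT : finGroupType) (G : {group gT}) (x z : gT) :
  extraspecial G -> x \in G -> x \notin 'Z(G)%g -> z \in 'Z(G)%g ->
  exists2 y, y \in G & [~ x, y]%g = z.
Proof.
move=> [[_ G'Z] prZ] Gx nZx Zz.
have /subsetPn[y Gy nCxy] : ~~ (G \subset 'C[x])%g.
  by apply: contra nZx => sGC; rewrite inE Gx -sub_cent1.
have Zc : [~ x, y]%g \in 'Z(G)%g by rewrite -G'Z mem_commg.
have ntc : [~ x, y]%g != 1%g.
  by apply: contra nCxy => /commgP cxy; exact/cent1P/esym.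
have /cycleP[i ->] : z \in <[[~ x, y]]>%g.
  apply: (fintype.subsetP _ _ Zz); apply: (prime_meetG prZ).
  by rewrite (finset.setIidPr _) ?cycle_subG ?cycle_eq1.
by exists (y ^+ i)%g; [exact: groupX | apply: commgX; apply: (centerC Gy)].
Qed.

(** * Symmetries of the Cayley graph *)

Section CayleyTransition.
Variables (R : realType) (gT : finGroupType) (G : {group gT}) (S : {set gT}).
Hypotheses (connS : connection_set G S) (normalS : union_of_classes G S).
Local Notation A := (adjacency_mx R (@Cay gT G S)).

Lemma Cay_hermsymmx : A \is hermsymmx.
Proof.
have [_ SV _ _] := connS.
apply/is_hermitianmxP; rewrite expr0 scale1r; apply/matrixP => i j.
by rewrite !mxE conjC_nat /Cay /= -[in LHS]SV mem_invg invMg invgK.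
Qed.

Lemma union_of_classesJ x y : y \in G -> (x ^ y \in S)%g = (x \in S).
Proof.
have SJ t u : u \in G -> t \in S -> (t ^ u \in S)%g.
  have [K sKG ->] := normalS => Gu /bigcupP[B KB Bt].
  apply/bigcupP; exists B => //.
  have /imsetP[v _ BE] := fintype.subsetP sKG _ KB.
  by move: Bt; rewrite BE => /imsetP[w Gw ->]; rewrite -conjgM memJ_class ?groupM.
by move=> Gy; apply/idP/idP => [/(SJ _ _ (groupVr Gy))|/SJ->//]; rewrite conjgK.
Qed.

(* The automorphism [t |-> t ^ y * z] of the Cayley graph maps 1 to z. *)
Lemma transition_Cay_row tau (y z x : subg_of G) : (x ^ y * z = x)%g ->
  transition_mx A tau (enum_rank z) (enum_rank x)
  = transition_mx A tau (enum_rank 1%g) (enum_rank x).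
Proof.
move=> xyz; pose s (t : subg_of G) := (t ^ y * z)%g.
have sI : injective s by move=> t u /mulIg /conjg_inj.
pose s' (i : 'I_#|subg_of G|) : 'I_#|subg_of G| := enum_rank (s (enum_val i)).
have s'I : injective s' by move=> i j /enum_rank_inj /sI /enum_val_inj.
have As i j : A (s' i) (s' j) = A i j.
  (* The factor [z] cancels in [s t * (s u)^-1], leaving [(t * u^-1) ^ y]. *)
  rewrite !mxE !enum_rankK /Cay /= -[in RHS](union_of_classesJ _ (subgP y)).
  by rewrite conjgE !invMg invgK !mulgA !mulgK.
have := transition_mx_invariant tau Cay_hermsymmx s'I As (enum_rank 1%g) (enum_rank x).
by rewrite /s' !enum_rankK /s conj1g mul1g xyz.
Qed.

End CayleyTransition.

Lemma unitarymx_orthogonal_rows (C : numClosedFieldType) n (U : 'M[C]_n) i i' :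
  U \is unitarymx -> i != i' -> \sum_j U i j * (U i' j)^* = 0.
Proof.
move=> /unitarymxP/matrixP/(_ i i'); rewrite !mxE => UU /negbTE ni.
by rewrite ni in UU; rewrite -[RHS]UU; apply: eq_bigr => j _; rewrite !mxE.
Qed.

(** Each term outside [D] equals [b ^+ 2], while the terms in [D] must cancel their sum; the
    triangle inequality then gives [#|~: D| <= #|D|]. *)
Lemma flat_orthogonal_card (C : numClosedFieldType) (I : finType)
    (u v : I -> C) (b : C) (D : {set I}) :
  0 < b -> (forall i, `|u i| = b) -> (forall i, `|v i| = b) ->
  (forall i, i \notin D -> u i = v i) -> \sum_i u i * (v i)^* = 0 ->
  (#|I| <= 2 * #|D|)%N.
Proof.
move=> b0 ub vb uv; rewrite (bigID (mem D)) /= => /eqP.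
have -> : \sum_(i | i \notin D) u i * (v i)^* = b ^+ 2 *+ #|~: D|.
  rewrite -sumr_const; apply: eq_big => [i|i nDi]; first by rewrite inE.
  by rewrite uv // -normCK vb.
rewrite addr_eq0 => /eqP/(congr1 (fun c => `|c|)).
rewrite normrN [RHS]ger0_norm ?mulrn_wge0 ?exprn_ge0 ?ltW // => DE.
have : b ^+ 2 *+ #|~: D| <= b ^+ 2 *+ #|D|.
  rewrite -DE -sumr_const; apply: le_trans (ler_norm_sum _ _ _) _.
  by apply: ler_sum => i _; rewrite normrM norm_conjC ub vb.
rewrite ler_pMn2l ?exprn_gt0 // => leD.
by rewrite -(cardsC D) mul2n -addnn leq_add2l.
Qed.

Theorem corollary6p3 (R : realType) (p : nat) (gT : finGroupType)
    (G : {group gT}) (S : {set gT}) (p_pr : prime p) (pG : (p.-group G)%g)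
    (esG : extraspecial G) (connS : connection_set G S)
    (normalS : union_of_classes G S) :
  ~ inst_uniform_mixing R (@Cay gT G S).
Proof.
move=> [tau _ flat].
have oZ : #|'Z(G)%g| = p := card_center_extraspecial pG esG.
have p_gt1 := prime_gt1 p_pr.
have /trivgPn[z0 Zz0 ntz0] : 'Z(G)%g != 1%g by rewrite trivg_card1 oZ neq_ltn p_gt1 orbT.
have Gz0 : z0 \in G := fintype.subsetP (center_sub G) _ Zz0.
pose z := subg G z0.
have zE : sgval z = z0 by exact: subgK.
have ntz : z != 1%g by apply: contra ntz0 => /eqP z1; rewrite -zE z1.
pose D : {set subg_of G} := [set x | sgval x \in 'Z(G)%g]%SET.
have oV : #|subg_of G| = #|G| by rewrite -cardsT -(card_isog (isog_subg G)).
have V_gt0 : (0 < #|subg_of G|)%N by rewrite oV cardG_gt0.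
pose U := transition_mx (adjacency_mx R (@Cay gT G S)) tau.
have : (#|subg_of G| <= 2 * #|D|)%N.
  apply: (@flat_orthogonal_card R[i] _ (fun x => U (enum_rank 1%g) (enum_rank x))
    (fun x => U (enum_rank z) (enum_rank x)) ((Num.sqrt #|subg_of G|%:R)^-1)%:C).
  - by rewrite ltcR invr_gt0 sqrtr_gt0 ltr0n.
  - by move=> x; exact: flat.
  - by move=> x; exact: flat.
  - move=> x; rewrite inE => nZx.
    (* Taking [[~ x, y] = z0^-1] gives [x ^ y * z0 = x * [~ x, y] * z0 = x]. *)
    have [y Gy xy] := extraspecial_commg_surj esG (subgP x) nZx (groupVr Zz0).
    apply/esym/(transition_Cay_row connS normalS tau (y := subg G y)).
    have xyz : (sgval x ^ y * z0)%g = sgval x by rewrite conjg_mulR xy mulgKV.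
    by apply: val_inj; rewrite /= !subgK.
  have unU : U \is unitarymx.
    exact: transition_mx_unitary (Cay_hermsymmx _ connS).
  have n1z : enum_rank (1%g : subg_of G) != enum_rank z.
    by rewrite (inj_eq enum_rank_inj) eq_sym.
  rewrite -[RHS](unitarymx_orthogonal_rows unU n1z).
  by rewrite [RHS](reindex enum_rank) //; apply: onW_bij; exact: enum_rank_bij.
apply/negP; rewrite -ltnNge oV.
have leD : (#|D| <= p)%N.
  rewrite -oZ -(card_imset D (@subg_inj _ G)); apply/subset_leq_card.
  by apply/fintype.subsetP => _ /imsetP[x Dx ->]; rewrite inE in Dx.
(* An extraspecial p-group has order at least [p ^ 3], which exceeds [2 * p] as [p > 1]. *)
apply: leq_trans (min_card_extraspecial pG esG).
by rewrite (@leq_ltn_trans (2 * p)) ?leq_mul2l // !expnS expn0 muln1; nia.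
Qed.
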